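(* Let $n\ge 1$. There is a constant $C>0$ depending only on $n$ such that the following holds. Let $\Omega\subset\mathbb{R}^n$ be a bounded open domain, let $\delta>0$ and $0<h<\delta/2$, let $\Omega_{\mathcal I}=\{y\in\mathbb{R}^n\setminus\Omega:\ \exists\,x\in\Omega \text{ with } |x-y|\le\delta\}$ and $\hat\Omega=\Omega\cup\Omega_{\mathcal I}$. For each $x\in\Omega$ let $B_{\delta,h}(x)\subset\mathbb{R}^n$ be an approximation of the Euclidean ball $B_\delta(x)$, and assume that $$B_{\delta-h}(x)\subset B_{\delta,h}(x)\subset B_{\delta+h}(x)\qquad\text{for all }x\in\Omega .$$ Then $$\sup_{x\in\Omega}\bigl|\hat\Omega\cap\Delta B_{\delta,h}(x)\bigr|+\sup_{x\in\hat\Omega}\bigl|\Omega\cap\Delta B'_{\delta,h}(x)\bigr|\ \le\ C\,h\,\delta^{n-1}.$$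
   Context: $|\cdot|$ of a vector is the Euclidean norm, and $|\cdot|$ of a set is its $n$-dimensional Lebesgue measure (all sets whose measure is taken are tacitly assumed measurable). $B_r(x)=\{y\in\mathbb{R}^n: |y-x|<r\}$ is the Euclidean ball of radius $r$ centered at $x$. An ''approximation'' $B_{\delta,h}(x)$ is simply a subset of $\mathbb{R}^n$ (in applications a polyhedral region) assigned to each $x\in\Omega$. Notation: - $\Delta B_{\delta,h}(x)=(B_\delta(x)\setminus B_{\delta,h}(x))\cup(B_{\delta,h}(x)\setminus B_\delta(x))$ for $x\in\Omega$; - $B'_{\delta,h}(x)=\{y\in\Omega:\ x\in B_{\delta,h}(y)\}$ for $x\in\hat\Omega$; - $\Delta B'_{\delta,h}(x)=(B_\delta(x)\setminus B'_{\delta,h}(x))\cup(B'_{\delta,h}(x)\setminus B_\delta(x))$ for $x\in\hat\Omega$. *)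

(* Defs.v *)
From HB Require Import structures.
From mathcomp Require Import all_boot all_order all_algebra.
From mathcomp Require Import all_classical all_reals all_analysis.

Set Implicit Arguments.
Unset Strict Implicit.
Unset Printing Implicit Defensive.

Import Order.TTheory GRing.Theory Num.Theory.
Import numFieldNormedType.Exports.

Local Open Scope classical_set_scope.
Local Open Scope ring_scope.

(* The canonical norm `|x| on 'rV[R]_n is the sup norm, hence a separate
   Euclidean norm and Euclidean balls. The topology and the bounded sets are
   the same for both norms, so open and bounded_set are the library's. *)
Definition enorm (R : realType) (n : nat) (x : 'rV[R]_n) : R :=
  Num.sqrt (\sum_(i < n) x ord0 i ^+ 2).

Definition eball (R : realType) (n : nat) (x : 'rV[R]_n) (r : R) :
    set 'rV[R]_n :=
  [set y | enorm (y - x) < r].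

(* Some (a, b) stands for the half-open box \prod_i ]a_i, b_i]; None is the
   empty box, so that countable covers may be finite. *)
Definition box (R : realType) (n : nat) (c : option ('rV[R]_n * 'rV[R]_n)) :
    set 'rV[R]_n :=
  if c is Some (a, b) then [set x | forall i, a ord0 i < x ord0 i <= b ord0 i]
  else set0.

(* The factor is 0 on an empty side b_i <= a_i. *)
Definition box_volume (R : realType) (n : nat)
    (c : option ('rV[R]_n * 'rV[R]_n)) : \bar R :=
  if c is Some (a, b)
  then (\prod_(i < n) Num.max 0 (b ord0 i - a ord0 i))%:E else 0%E.

Definition lebesgue_outer (R : realType) (n : nat) (A : set 'rV[R]_n) : \bar R :=
  ereal_inf [set (\sum_(k <oo) box_volume (c k))%E |
    c in [set c : nat -> option ('rV[R]_n * 'rV[R]_n) |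
           A `<=` \bigcup_k box (c k)]].

Section lebesgue_outer_measure.
Local Open Scope ereal_scope.
Variables (R : realType) (n : nat).
Local Notation mu := (@lebesgue_outer R n).

Lemma box_volume_ge0 (c : option ('rV[R]_n * 'rV[R]_n)) : 0 <= box_volume c.
Proof.
case: c => [[a b]|] //=; rewrite lee_fin.
by apply: prodr_ge0 => i _; rewrite le_max lexx.
Qed.

Lemma lebesgue_outer_ge0 (A : set 'rV[R]_n) : 0 <= mu A.
Proof.
apply: le_ereal_inf_tmp => _ [c _ <-].
by apply: nneseries_ge0 => k _ _; exact: box_volume_ge0.
Qed.

Lemma lebesgue_outer0 : mu set0 = 0.
Proof.
apply/eqP; rewrite eq_le lebesgue_outer_ge0 andbT.
by apply: ereal_inf_lbound; exists (fun=> None) => //; rewrite eseries0.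
Qed.

Lemma le_lebesgue_outer : {homo mu : A B / A `<=` B >-> A <= B}.
Proof.
move=> A B AB; apply/ereal_inf_le_tmp => _ [c Bc <-].
by exists c => //; exact: subset_trans Bc.
Qed.

Lemma lebesgue_outer_sigma_subadditive : sigma_subadditive mu.
Proof.
move=> A; have [[i ioo]|] := pselect (exists i, mu (A i) = +oo).
  rewrite (eseries_pinfty _ _ ioo) ?leey// => k _.
  by rewrite -ltNye (lt_le_trans _ (lebesgue_outer_ge0 _)).
rewrite -forallNE => Aoo.
apply/lee_addgt0Pr => _/posnumP[e].
rewrite (le_trans _ (epsilon_trick _ _ _))//; last first.
  by move=> k; exact: lebesgue_outer_ge0.
pose P k (c : nat -> option ('rV[R]_n * 'rV[R]_n)) :=
  A k `<=` \bigcup_j box (c j) /\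
  \sum_(j <oo) box_volume (c j) <= mu (A k) + (e%:num / (2 ^ k.+1)%:R)%:E.
have [G PG] : {G & forall k, P k (G k)}.
  apply: (@choice _ _ P) => k.
  have mufin : mu (A k) \is a fin_num.
    by rewrite ge0_fin_numE ?lebesgue_outer_ge0// ltey; apply/eqP/Aoo.
  have ek : (0 < e%:num / (2 ^ k.+1)%:R :> R)%R by [].
  have [_ [c Ac <-] cmu] := lb_ereal_inf_adherent ek mufin.
  by exists c; split => //; exact: ltW.
have vol0 p : 0 <= (@box_volume R n \o uncurry G) p by exact: box_volume_ge0.
apply: (@le_trans _ _ (\esum_(p in setT) (@box_volume R n \o uncurry G) p)).
  have /card_esym/ppcard_eqP[f] := card_nat2.
  apply: ereal_inf_lbound; exists (uncurry G \o f) => /=.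
    move=> t [i _ /(PG i).1[j _ Gijt]]; exists (f^-1%FUN (i, j)) => //=.
    by rewrite invK ?inE.
  rewrite -(esum_pred_image (@box_volume R n \o uncurry G) _ xpredT)
    ?[fun=> _]set_true//.
  by rewrite image_eq.
rewrite (_ : esum _ _ = \sum_(i <oo) \sum_(j <oo) box_volume (G i j));
    last first.
  pose J : nat -> set (nat * nat) := fun i => [set (i, j) | j in setT].
  rewrite (_ : setT = \bigcup_k J k); last first.
    by rewrite predeqE => -[a b]; split => // _; exists a => //; exists b.
  rewrite esum_bigcupT /=; last 2 first.
    - apply/trivIsetP => i j _ _ ij.
      rewrite predeqE => -[k m] /=; split => //= -[] [_] _ [<-{k} _].
      by move=> [m' _] [] /esym/eqP; rewrite (negbTE ij).
    - by move=> p; exact: vol0.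
  rewrite -(image_id [set: nat]) -fun_true esum_pred_image//; last first.
    by move=> k _; apply: esum_ge0 => p _; exact: box_volume_ge0.
  apply: eq_eseriesr => /= j _.
  rewrite -(esum_pred_image (@box_volume R n \o uncurry G) (pair j) predT)//=;
    [|by move=> ? _; exact: box_volume_ge0|by move=> ? ? _ _ []].
  by congr esum; rewrite predeqE => -[a b]; split; move=> [i _ <-]; exists i.
apply: lee_nneseries => [k _ _|k _]; last exact: (PG k).2.
by apply: nneseries_ge0 => m _ _; exact: box_volume_ge0.
Qed.

HB.instance Definition _ := isOuterMeasure.Build R _ mu lebesgue_outer0
  lebesgue_outer_ge0 le_lebesgue_outer lebesgue_outer_sigma_subadditive.

End lebesgue_outer_measure.

(* The Lebesgue sigma-algebra of R^n (Caratheodory's criterion). *)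
Definition lebesgue_measurable (R : realType) (n : nat) :
    set (set 'rV[R]_n) :=
  (@lebesgue_outer R n).-cara.-measurable.

Definition lebesgue_measure_rV (R : realType) (n : nat) :
    set (caratheodory_type (@lebesgue_outer R n)) -> \bar R :=
  @lebesgue_outer R n.

HB.instance Definition _ (R : realType) (n : nat) :=
  isMeasure.Build _ _ _ (@lebesgue_measure_rV R n)
    (caratheodory_measure0 (@lebesgue_outer R n))
    (caratheodory_measure_ge0 (mu := @lebesgue_outer R n))
    (@caratheodory_measure_sigma_additive _ _ (@lebesgue_outer R n)).

Definition interaction_domain (R : realType) (n : nat) (Omega : set 'rV[R]_n)
    (delta : R) : set 'rV[R]_n :=
  [set y | ~ Omega y /\ exists2 x, Omega x & enorm (x - y) <= delta].

Definition hat_domain (R : realType) (n : nat) (Omega : set 'rV[R]_n)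
    (delta : R) : set 'rV[R]_n :=
  Omega `|` interaction_domain Omega delta.

Section approximate_balls.
Variables (R : realType) (n : nat) (Omega : set 'rV[R]_n) (delta : R).
(* B x is B_{delta,h}(x); only its values at points of Omega matter. *)
Variable B : 'rV[R]_n -> set 'rV[R]_n.

Definition dual_ball (x : 'rV[R]_n) : set 'rV[R]_n :=
  [set y | Omega y /\ B y x].

Definition ball_diff (x : 'rV[R]_n) : set 'rV[R]_n :=
  (eball x delta `\` B x) `|` (B x `\` eball x delta).

Definition dual_ball_diff (x : 'rV[R]_n) : set 'rV[R]_n :=
  (eball x delta `\` dual_ball x) `|` (dual_ball x `\` eball x delta).

End approximate_balls.

(* Main.v *)
Require Import Defs.
From mathcomp Require Import all_boot all_order all_algebra.
From mathcomp Require Import all_classical all_reals all_analysis.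
From mathcomp Require Import ring lra.
Import Order.TTheory GRing.Theory Num.Theory.
Import numFieldNormedType.Exports.
Local Open Scope classical_set_scope.
Local Open Scope ring_scope.

(** Both symmetric differences are contained in the spherical shell of points y
    with delta - h <= |y - x| < delta + h; for the dual ball this uses the
    symmetry of |x - y|. Since the outer measure is monotone, it is enough to
    bound the outer measure of the shell by a constant times h delta^(n-1).

    The bound comes from covering the shell by boxes. Every point of the shell
    has a coordinate i with |y_i - x_i| >= delta / (2 n), by [large_coord], so
    the shell is a union of 2 n pieces indexed by i and by the sign of
    y_i - x_i. On one piece the sphere-like surface is a graph over the other
    coordinates that is not steep: moving those by at most h changes y_i^2 by
    less than 4 n delta h, hence y_i by less than 4 n^2 h
    ([shell_oscillation]). Cutting the range of the other n - 1 coordinates, of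
    length 4 delta, into intervals of a length s <= h therefore covers the piece
    by boxes of height O(h) whose bases have total volume (4 delta)^(n-1); this
    is [lebesgue_outer_thin]. The number of boxes is irrelevant, as only the
    total volume of the bases enters. *)

(** * Covering by boxes *)

Lemma lebesgue_outer_box {R : realType} {n : nat} (a b : 'rV[R]_n) :
  (lebesgue_outer (box (Some (a, b))) <= box_volume (Some (a, b)))%E.
Proof.
pose c (k : nat) : option ('rV[R]_n * 'rV[R]_n) :=
  if k == 0%N then Some (a, b) else None.
apply: ereal_inf_lbound; exists c.
  by move=> y aby; exists 0%N.
rewrite nneseries_recl//; last by move=> k _; exact: box_volume_ge0.
by rewrite eseries0 ?adde0// => -[].
Qed.

Lemma lebesgue_outer_finite_cover {R : realType} {n : nat} (I : finType)
    (A : set 'rV[R]_n) (F : I -> set 'rV[R]_n) (w : R) :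
  (forall y, A y -> exists i, F i y) ->
  (forall i, lebesgue_outer (F i) <= w%:E)%E ->
  (lebesgue_outer A <= (#|I|%:R * w)%:E)%E.
Proof.
move=> AF Fw.
have AU : A `<=` \big[setU/set0]_(i : I) F i.
  by move=> y /AF[i Fiy]; rewrite (bigD1 i)//=; left.
apply: le_trans (le_lebesgue_outer AU) _.
have -> : (#|I|%:R * w)%:E = (\sum_(i : I) w%:E)%E.
  by rewrite sumEFin sumr_const mulr_natl.
elim/big_rec2 : _ => [|i e B _ Be]; first by rewrite lebesgue_outer0.
apply: le_trans (outer_measureU2 _ _ _) _.
by apply: leeD => //; exact: Fw.
Qed.

Lemma itv_subdivision {R : realType} (s a t : R) (M : nat) :
  a < t <= a + s *+ M -> exists k : 'I_M, a + s *+ k < t <= a + s *+ k.+1.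
Proof.
elim: M => [|M IH] /andP[at_ tM].
  by move: (lt_le_trans at_ tM); rewrite mulr0n addr0 ltxx.
have [tM'|tM'] := leP t (a + s *+ M).
  have [|k kt] := IH; first by rewrite at_.
  by exists (widen_ord (leqnSn M) k).
by exists ord_max; rewrite tM'.
Qed.

(** A set over a cube of side L that varies by less than K in the direction i
    whenever the other coordinates move by at most h. The base is cut into cells
    of side s = L / M <= h; above one cell the set lies within K of the height
    of any of its points, so each cell costs s^m * 2K and all of them together
    (s M)^m * 2K = L^m * 2K, whatever h is. *)
Lemma lebesgue_outer_thin {R : realType} {m : nat} (A : set 'rV[R]_m.+1)
    (i : 'I_m.+1) (a : 'rV[R]_m.+1) (L h K : R) :
  0 < L -> 0 < h -> 0 <= K ->
  (forall y j, A y -> j != i -> a ord0 j < y ord0 j <= a ord0 j + L) ->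
  (forall y z, A y -> A z ->
     (forall j, j != i -> `|y ord0 j - z ord0 j| <= h) ->
     `|y ord0 i - z ord0 i| < K) ->
  (lebesgue_outer A <= (L ^+ m * (2 * K))%:E)%E.
Proof.
move=> L0 h0 K0 AL AK.
pose M := (Num.trunc (L / h)).+1; pose s := L / M%:R.
have M0 : 0 < M%:R :> R by rewrite ltr0n.
have s0 : 0 < s by rewrite divr_gt0.
have sh : s <= h.
  by rewrite ler_pdivrMr// mulrC -ler_pdivrMr// ltW// truncnS_gt.
have sM : s *+ M = L by rewrite -mulr_natr divfK// gt_eqF.
pose cell (k : {ffun 'I_m -> 'I_M}) := [set y | A y /\ forall j,
  a ord0 (lift i j) + s *+ k j < y ord0 (lift i j)
    <= a ord0 (lift i j) + s *+ (k j).+1].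
have -> : L ^+ m * (2 * K) =
    #|{ffun 'I_m -> 'I_M}|%:R * (s ^+ m * (2 * K)).
  by rewrite card_ffun !card_ord natrX [RHS]mulrA -exprMn [M%:R * _]mulr_natl sM.
apply: (@lebesgue_outer_finite_cover _ _ _ _ cell) => [y Ay|k].
  have /choice[k kP] : forall j, exists k : 'I_M,
      a ord0 (lift i j) + s *+ k < y ord0 (lift i j)
        <= a ord0 (lift i j) + s *+ k.+1.
    by move=> j; apply: itv_subdivision; rewrite sM AL// eq_sym neq_lift.
  by exists [ffun j => k j]; split=> // j; rewrite ffunE.
have [[p [Ap pk]]|ck0] := pselect (cell k !=set0); last first.
  have -> : cell k = set0.
    by apply/seteqP; split=> // y cy; case: ck0; exists y.
  by rewrite lebesgue_outer0 lee_fin !mulr_ge0 ?exprn_ge0// ltW.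
(* [unlift i j] is [None] exactly at j = i; elsewhere it gives the position of
   j among the m base coordinates. *)
pose lo := \row_j if unlift i j is Some j' then a ord0 j + s *+ k j'
                  else p ord0 i - K.
pose hi := \row_j if unlift i j is Some j' then a ord0 j + s *+ (k j').+1
                  else p ord0 i + K.
have -> : (s ^+ m * (2 * K))%:E = box_volume (Some (lo, hi)).
  congr EFin; rewrite (bigD1_ord i)//= !mxE unlift_none.
  have -> : Num.max 0 (p ord0 i + K - (p ord0 i - K)) = 2 * K.
    by rewrite (_ : _ - _ = 2 * K); [apply/max_idPr; rewrite mulr_ge0|ring].
  rewrite mulrC; congr (_ * _).
  under eq_bigr => j _.
    rewrite !mxE liftK mulrSr.
    rewrite (_ : _ - _ = s); last by ring.
    rewrite (max_idPr (ltW s0)).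
    over.
  by rewrite prodr_const card_ord.
apply: le_trans (lebesgue_outer_box _ _); apply: le_lebesgue_outer.
move=> y [Ay yk] j /=; rewrite !mxE; case: unliftP => [j' ->|->]; first exact: yk.
have : `|y ord0 i - p ord0 i| < K.
  apply: AK => // j0; case: (unliftP i j0) => [j' ->|->]; rewrite ?eqxx// => _.
  have /andP[y1 y2] := yk j'; have /andP[p1 p2] := pk j'.
  apply: le_trans sh; rewrite mulrSr in y2 p2; rewrite ler_norml; lra.
by rewrite ltr_norml; lra.
Qed.

(** * Spherical shells *)

Definition shell {R : realType} {n : nat} (x : 'rV[R]_n) (r1 r2 : R) :
  set 'rV[R]_n := eball x r2 `\` eball x r1.

Lemma shellP {R : realType} {n : nat} {x y : 'rV[R]_n} {r1 r2 : R} :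
  0 <= r1 -> 0 <= r2 -> shell x r1 r2 y ->
  r1 ^+ 2 <= \sum_(j < n) (y - x) ord0 j ^+ 2 < r2 ^+ 2.
Proof.
move=> r10 r20 [/= y2 /negP]; rewrite -leNgt => y1.
have S0 : 0 <= \sum_(j < n) (y - x) ord0 j ^+ 2.
  by apply: sumr_ge0 => j _; exact: sqr_ge0.
have e0 : 0 <= enorm (y - x) by exact: sqrtr_ge0.
rewrite -(sqr_sqrtr S0) -/(enorm _).
by rewrite ler_pXn2r// ltr_pXn2r// y1 y2.
Qed.

Lemma coord_lt_of_sum_sqr {R : realType} {n : nat} {u : 'rV[R]_n} {r : R}
    (j : 'I_n) :
  0 <= r -> \sum_(j < n) u ord0 j ^+ 2 < r ^+ 2 -> `|u ord0 j| < r.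
Proof.
move=> r0 ur; rewrite -(@ltr_pXn2r _ 2)// ?nnegrE// real_normK ?num_real//.
apply: le_lt_trans ur; rewrite (bigD1 j)//= lerDl.
by apply: sumr_ge0 => k _; exact: sqr_ge0.
Qed.

(** The bound r / n is not the optimal r / sqrt n, but it suffices since the
    constant is only required to depend on n. *)
Lemma large_coord {R : realType} {m : nat} (u : 'rV[R]_m.+1) (r : R) :
  0 < r -> r ^+ 2 <= \sum_j u ord0 j ^+ 2 ->
  exists j, r / m.+1%:R <= `|u ord0 j|.
Proof.
move=> r0 ru; apply/not_existsP => u_small.
have N1 : 1 <= m.+1%:R :> R by rewrite ler1n.
have N0 : 0 < m.+1%:R :> R by rewrite ltr0n.
suff : \sum_j u ord0 j ^+ 2 < r ^+ 2 by rewrite ltNge ru.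
apply: (@lt_le_trans _ _ (\sum_(j < m.+1) (r / m.+1%:R) ^+ 2)).
  apply: ltr_sum => [|j _]; first by apply/hasP; exists ord0; rewrite ?mem_index_enum.
  have /negP := u_small j; rewrite -ltNge => uj.
  rewrite -(real_normK (num_real (u ord0 j))) ltr_pXn2r// nnegrE//.
  by rewrite divr_ge0// ltW.
rewrite sumr_const card_ord -[_ *+ _]mulr_natr.
have -> : (r / m.+1%:R) ^+ 2 * m.+1%:R = r ^+ 2 / m.+1%:R.
  by field; rewrite gt_eqF// ltr0n.
by rewrite ler_pdivrMr// ler_peMr// sqr_ge0.
Qed.

(** The difference of u_i^2 and v_i^2 is controlled by the thickness
    (delta + h)^2 - (delta - h)^2 = 4 delta h of the shell in squared radius
    plus at most 4 delta h for each other coordinate. Dividing by |u_i + v_i|,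
    which is at least delta / n because u_i and v_i have the same sign and are
    large, turns this into a bound on u_i - v_i. *)
Lemma shell_oscillation {R : realType} {m : nat} (u v : 'rV[R]_m.+1)
    (delta h : R) (b : bool) (i : 'I_m.+1) :
  0 < h -> h < delta / 2 ->
  (delta - h) ^+ 2 <= \sum_j u ord0 j ^+ 2 < (delta + h) ^+ 2 ->
  (delta - h) ^+ 2 <= \sum_j v ord0 j ^+ 2 < (delta + h) ^+ 2 ->
  delta / 2 / m.+1%:R <= (-1) ^+ b * u ord0 i ->
  delta / 2 / m.+1%:R <= (-1) ^+ b * v ord0 i ->
  (forall j, j != i -> `|u ord0 j - v ord0 j| <= h) ->
  `|u ord0 i - v ord0 i| < 4 * m.+1%:R ^+ 2 * h.
Proof.
move=> h0 hd /andP[u1 u2] /andP[v1 v2] ui vi uv.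
have N0 : 0 < m.+1%:R :> R by rewrite ltr0n.
have d0 : 0 < delta by lra.
have dh0 : 0 <= delta + h by lra.
have other : `|\sum_(j < m) (u ord0 (lift i j) ^+ 2 - v ord0 (lift i j) ^+ 2)|
    <= (4 * delta * h) *+ m.
  rewrite -[X in _ <= _ *+ X]card_ord -sumr_const.
  apply: le_trans (ler_norm_sum _ _ _) _; apply: ler_sum => j _.
  have uj := coord_lt_of_sum_sqr (lift i j) dh0 u2.
  have vj := coord_lt_of_sum_sqr (lift i j) dh0 v2.
  rewrite subr_sqr normrM mulrC ler_pM//.
    by apply: le_trans (ler_normD _ _) _; lra.
  by apply: uv; rewrite eq_sym neq_lift.
(* The inequality is strict because the shell is half-open. *)
have sqr_osc : `|u ord0 i ^+ 2 - v ord0 i ^+ 2| < 4 * delta * h * m.+1%:R.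
  move: u1 u2 v1 v2 other; rewrite !(bigD1_ord i)//= sumrB.
  set U := \sum_(j < m) _; set V := \sum_(j < m) _.
  move=> u1 u2 v1 v2; rewrite -[_ *+ m]mulr_natr -(natr1 m) ler_norml ltr_norml.
  case/andP=> o1 o2.
  have -> : 4 * delta * h * (m%:R + 1) =
    4 * delta * h * m%:R + ((delta + h) ^+ 2 - (delta - h) ^+ 2) by ring.
  by apply/andP; split; lra.
set p := (-1) ^+ b * u ord0 i in ui; set q := (-1) ^+ b * v ord0 i in vi.
have pE : u ord0 i ^+ 2 = p ^+ 2 by rewrite exprMn sqrr_sign mul1r.
have qE : v ord0 i ^+ 2 = q ^+ 2 by rewrite exprMn sqrr_sign mul1r.
have -> : `|u ord0 i - v ord0 i| = `|p - q|.
  by rewrite -mulrBr normrM normr_sign mul1r.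
have c0 : 0 < delta / m.+1%:R by rewrite divr_gt0.
have pq : delta / m.+1%:R <= p + q.
  have -> : delta / m.+1%:R = delta / 2 / m.+1%:R + delta / 2 / m.+1%:R.
    by field; rewrite gt_eqF.
  by rewrite lerD.
rewrite -(@ltr_pM2r _ (delta / m.+1%:R))//.
have -> : 4 * m.+1%:R ^+ 2 * h * (delta / m.+1%:R) = 4 * delta * h * m.+1%:R.
  by field; rewrite gt_eqF.
apply: le_lt_trans sqr_osc; rewrite pE qE subr_sqr normrM ler_wpM2l//.
by apply: le_trans pq _; exact: ler_norm.
Qed.

Lemma lebesgue_outer_shell {R : realType} {m : nat} (x : 'rV[R]_m.+1)
    (delta h : R) :
  0 < h -> h < delta / 2 ->
  (lebesgue_outer (shell x (delta - h) (delta + h)) <=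
    (16 * m.+1%:R ^+ 3 * 4 ^+ m * h * delta ^+ m)%:E)%E.
Proof.
move=> h0 hd.
have d0 : 0 < delta by lra.
have dh1 : 0 <= delta - h by lra.
have dh2 : 0 <= delta + h by lra.
pose piece (ib : 'I_m.+1 * bool) := [set y | shell x (delta - h) (delta + h) y
  /\ delta / 2 / m.+1%:R <= (-1) ^+ ib.2 * (y - x) ord0 ib.1].
have -> : 16 * m.+1%:R ^+ 3 * 4 ^+ m * h * delta ^+ m =
    #|{: 'I_m.+1 * bool}|%:R *
      ((4 * delta) ^+ m * (2 * (4 * m.+1%:R ^+ 2 * h))).
  by rewrite card_prod card_ord card_bool natrM exprMn; ring.
apply: (@lebesgue_outer_finite_cover _ _ _ _ piece) => [y ys|[i b]].
  have /andP[y1 _] := shellP dh1 dh2 ys.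
  have d20 : 0 < delta / 2 by rewrite divr_gt0.
  have [|i yi] := @large_coord _ _ (y - x) (delta / 2) d20.
    by apply: le_trans y1; rewrite ler_pXn2r ?nnegrE//; lra.
  exists (i, (y - x) ord0 i < 0); split=> //=.
  by rewrite -normrEsign.
(* The shell lies in the open ball of radius delta + h < 2 delta, hence over the
   cube of side 4 delta centred at x. *)
apply: (@lebesgue_outer_thin _ _ _ i (x - const_mx (2 * delta)) _ h) => //.
- by rewrite mulr_gt0.
- by rewrite !mulr_ge0// ?exprn_ge0// ltW.
- move=> y j [ys _] _; have /andP[_ y2] := shellP dh1 dh2 ys.
  have := coord_lt_of_sum_sqr j dh2 y2.
  by rewrite !mxE ltr_norml; lra.
move=> y z [ys yi] [zs zi] yz.
have subC j : y ord0 j - z ord0 j = (y - x) ord0 j - (z - x) ord0 j.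
  by rewrite !mxE; ring.
rewrite subC; apply: (@shell_oscillation _ _ _ _ delta _ b) => //.
- exact: shellP.
- exact: shellP.
- by move=> j ji; rewrite -subC yz.
Qed.

(** * The symmetric differences *)

Lemma enormB {R : realType} {n : nat} (x y : 'rV[R]_n) :
  enorm (x - y) = enorm (y - x).
Proof.
congr Num.sqrt; apply: eq_bigr => j _.
by rewrite -(opprB y x) mxE sqrrN.
Qed.

Lemma ball_diff_shell {R : realType} {n : nat} (delta h : R)
    (B : 'rV[R]_n -> set 'rV[R]_n) (x : 'rV[R]_n) :
  0 < h -> eball x (delta - h) `<=` B x -> B x `<=` eball x (delta + h) ->
  ball_diff delta B x `<=` shell x (delta - h) (delta + h).
Proof.
move=> h0 xB Bx y [[yd yB]|[yB yd]]; split=> /=.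
- by apply: lt_trans yd _; lra.
- by move=> /xB.
- exact: Bx.
- by move=> yd'; apply: yd; apply: lt_trans yd' _; lra.
Qed.

(** For y in Omega, x lies in [B y] exactly when y lies in the dual ball at x,
    so y in the dual difference at x puts x in the difference at y, and the
    shells are symmetric in their centre and point. *)
Lemma dual_ball_diff_shell {R : realType} {n : nat} (Omega : set 'rV[R]_n)
    (delta h : R) (B : 'rV[R]_n -> set 'rV[R]_n) (x : 'rV[R]_n) :
  0 < h ->
  (forall y, Omega y ->
    eball y (delta - h) `<=` B y /\ B y `<=` eball y (delta + h)) ->
  Omega `&` dual_ball_diff Omega delta B x
    `<=` shell x (delta - h) (delta + h).
Proof.
move=> h0 OB y [Oy yx].
have [yB By] := OB _ Oy.
suff [xs1 xs2] : shell y (delta - h) (delta + h) x.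
  by split; rewrite /eball/= enormB.
apply: (ball_diff_shell delta h B y h0 yB By).
case: yx => [[yd yB']|[[_ yB'] yd]]; [left|right]; split=> //=.
- by rewrite /eball/= enormB.
- by move=> xB; apply: yB'.
- by rewrite /eball/= enormB.
Qed.

Theorem theorem3p3 (R : realType) (n : nat) (n_ge1 : (1 <= n)%N) :
  exists C : R, 0 < C /\
    forall (Omega : set 'rV[R]_n) (delta h : R) (B : 'rV[R]_n -> set 'rV[R]_n),
      open Omega -> bounded_set Omega ->
      0 < delta -> 0 < h -> h < delta / 2 ->
      (forall x, Omega x ->
        eball x (delta - h) `<=` B x /\ B x `<=` eball x (delta + h)) ->
      (forall x, Omega x ->
        lebesgue_measurable
          (hat_domain Omega delta `&` ball_diff delta B x)) ->
      (forall x, hat_domain Omega delta x ->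
        lebesgue_measurable (Omega `&` dual_ball_diff Omega delta B x)) ->
      (ereal_sup [set lebesgue_measure_rV
                        (hat_domain Omega delta `&` ball_diff delta B x)
                 | x in Omega] +
       ereal_sup [set lebesgue_measure_rV
                        (Omega `&` dual_ball_diff Omega delta B x)
                 | x in hat_domain Omega delta]
       <= (C * h * delta ^+ n.-1)%:E)%E.
Proof.
case: n n_ge1 => // m _.
(* Each of the two suprema is at most C1 h delta^m. *)
pose C1 : R := 16 * m.+1%:R ^+ 3 * 4 ^+ m.
exists (C1 + C1); split.
  by rewrite addr_gt0// !mulr_gt0// exprn_gt0// ltr0n.
move=> Omega delta h B _ _ _ h0 hd OB _ _ /=.
rewrite !mulrDl EFinD.
apply: leeD; apply: ge_ereal_sup => _ [x xO <-].
- apply: le_trans (lebesgue_outer_shell x delta h h0 hd); apply: le_lebesgue_outer.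
  apply: subset_trans (@subIsetr _ _ _) _.
  by apply: ball_diff_shell => //; have [] := OB _ xO.
- apply: le_trans (lebesgue_outer_shell x delta h h0 hd); apply: le_lebesgue_outer.
  exact: dual_ball_diff_shell.
Qed.
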